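(* For $A,B\in\mathbb{C}_{n,n}$ with core-EP decompositions $A=A_1+A_2$ and $B=B_1+B_2$, define $$A\mathop{\le}\limits^{\mathrm{WG}}B\quad\text{if and only if}\quad A_1\mathop{\le}\limits^{\#}B_1 .$$ Then $\mathop{\le}\limits^{\mathrm{WG}}$ is a pre-order on $\mathbb{C}_{n,n}$ (i.e. it is reflexive and transitive).
   Context: $\mathbb{C}_{n,n}$ is the set of complex $n\times n$ matrices and $A^\ast$ the conjugate transpose. The index $\mathrm{Ind}(A)$ is the smallest positive integer $k$ with $\mathrm{rk}(A^{k+1})=\mathrm{rk}(A^k)$. Core-EP decomposition (known): every $A\in\mathbb{C}_{n,n}$ with $\mathrm{Ind}(A)=k$ can be written uniquely as $A=A_1+A_2$ with $\mathrm{Ind}(A_1)=1$, $A_2^k=0$ and $A_1^\ast A_2=A_2A_1=0$ (one or both may be null). For a matrix $M$ of index one, the group inverse $M^\#$ is the unique $X$ with $XM^2=M$, $XMX=X$, $MX=XM$. The sharp partial order on matrices of index one: $M\mathop{\le}\limits^{\#}M'$ means $MM^\#=M'M^\#$ and $M^\#M=M^\#M'$. *)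

(* Defs.v *)
From mathcomp Require Import all_boot all_order all_algebra.
From mathcomp Require Import complex.
From mathcomp Require Import classical_sets reals.
From mathcomp Require Import spectral.

Set Implicit Arguments.
Unset Strict Implicit.
Unset Printing Implicit Defensive.

Import GRing.Theory.

Local Open Scope ring_scope.
Local Open Scope complex_scope.
Local Open Scope sesquilinear_scope.

Lemma mxindex_exists (F : fieldType) (n : nat) (A : 'M[F]_n) :
  exists k, (0 < k)%N && (\rank (A ^+ k.+1) == \rank (A ^+ k)).
Proof.
case: (boolP [exists k : 'I_n.+1, \rank (A ^+ k.+2) == \rank (A ^+ k.+1)]).
  by case/existsP=> k Hk; exists k.+1.
move/existsPn=> Hne.
have drop k : (k <= n.+1)%N -> (\rank (A ^+ k.+1) + k <= n)%N.
  elim: k => [|k IHk] lekn; first by rewrite addn0 rank_leq_row.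
  apply: leq_trans (IHk (ltnW lekn)); rewrite addnS ltn_add2r.
  rewrite ltn_neqAle (Hne (Ordinal lekn)) /=.
  by rewrite (exprS A k.+1) -mulmxE mxrankM_maxr.
by have := drop _ (leqnn n.+1); rewrite addnS ltnNge leq_addl.
Qed.

(* The minimum is over k >= 1, so invertible matrices have index 1, not 0. *)
Definition mxindex (F : fieldType) (n : nat) (A : 'M[F]_n) : nat :=
  ex_minn (mxindex_exists A).

Definition is_group_inverse (F : fieldType) (n : nat) (M X : 'M[F]_n) : Prop :=
  [/\ X *m (M *m M) = M, X *m M *m X = X & M *m X = X *m M].

(* M^#; the default value 0 occurs only when the index of M is not 1. *)
Definition group_inverse (F : fieldType) (n : nat) (M : 'M[F]_n) : 'M[F]_n :=
  xget 0 [set X | is_group_inverse M X]%classic.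

Definition sharp_le (F : fieldType) (n : nat) (M M' : 'M[F]_n) : Prop :=
  [/\ mxindex M = 1%N, mxindex M' = 1%N,
      M *m group_inverse M = M' *m group_inverse M
    & group_inverse M *m M = group_inverse M *m M'].

Definition core_EP (R : realType) (n : nat) (A A1 A2 : 'M[R[i]]_n) : Prop :=
  [/\ A = A1 + A2, mxindex A1 = 1%N, A2 ^+ mxindex A = 0,
      A1 ^t* *m A2 = 0 & A2 *m A1 = 0].

(* The core-EP decomposition of a matrix exists and is unique, so quantifying
   existentially over decompositions of A and B only names their parts. *)
Definition WG_le (R : realType) (n : nat) (A B : 'M[R[i]]_n) : Prop :=
  exists A1 A2 B1 B2 : 'M[R[i]]_n,
    [/\ core_EP A A1 A2, core_EP B B1 B2 & sharp_le A1 B1].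

(* Main.v *)
Require Import Defs.
From mathcomp Require Import all_boot all_order all_algebra.
From mathcomp Require Import complex.
From mathcomp Require Import classical_sets reals.
From mathcomp Require Import spectral.

(** The order [WG_le] is the sharp order pulled back along the map sending a
    matrix to the index-one part of its core-EP decomposition.  The sharp
    order is a pre-order on matrices of index one, so the pull-back is a
    pre-order as soon as that map is well defined: existence of the
    decomposition ([core_EP_exists]) gives reflexivity, and uniqueness
    ([core_EP_unique]) allows the two decompositions of the middle matrix to
    be matched, so that [sharp_le_trans] gives transitivity.

    Both halves of the decomposition theorem rest on one fact about the power
    [M := A ^+ k], where [k] is the index of [A]: the index-one part is
    [A1 = P A], with [P] the orthogonal projector onto the range of [M].
    The projector itself is never formed.  Instead [A1] is any [M Y] with
    [M^* A = M^* M Y] (the normal equations), and all identities between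
    matrices with range in that of [M] are obtained by cancelling [M^*]: if
    [M^* (M D) = 0] then [M D = 0], because [M D] is orthogonal to
    itself. *)

Set Implicit Arguments.
Unset Strict Implicit.
Unset Printing Implicit Defensive.

Import GRing.Theory Num.Theory.

Local Open Scope ring_scope.
Local Open Scope complex_scope.
Local Open Scope sesquilinear_scope.

(** * Matrices of index one and the group inverse *)

(** A product of the same rank as its first factor has the same column space,
    so the first factor can be recovered from it. *)
Lemma mxrank_mulr_eq (F : fieldType) (m n p : nat)
    (M : 'M[F]_(m, n)) (N : 'M[F]_(n, p)) :
  \rank (M *m N) = \rank M -> exists T, M = M *m N *m T.
Proof.
rewrite -mxrank_tr -[RHS]mxrank_tr trmx_mul => /eqP rk.
have := submxMl N^T M^T.
move/mxrank_leqif_sup => lif; move: rk; rewrite (lif.2) => /submxP [W MW].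
by exists W^T; apply: trmx_inj; rewrite !trmx_mul trmxK.
Qed.

Lemma mxrank_mull_eq (F : fieldType) (m n p : nat)
    (M : 'M[F]_(n, p)) (N : 'M[F]_(m, n)) :
  \rank (N *m M) = \rank M -> exists W, M = W *m (N *m M).
Proof.
move/eqP; rewrite ((mxrank_leqif_sup (submxMl N M)).2).
by case/submxP => W; exists W.
Qed.

Lemma mxindexP (F : fieldType) (n : nat) (A : 'M[F]_n) :
  (0 < mxindex A)%N /\ \rank (A ^+ (mxindex A).+1) = \rank (A ^+ mxindex A).
Proof. by rewrite /mxindex; case: ex_minnP => k /andP[-> /eqP]. Qed.

Lemma mxindex1_rank (F : fieldType) (n : nat) (M : 'M[F]_n) :
  mxindex M = 1%N -> \rank (M *m M) = \rank M.
Proof. by case: (mxindexP M) => _ /[swap] ->; rewrite expr2 expr1. Qed.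

Lemma mxindex1_intro (F : fieldType) (n : nat) (M X : 'M[F]_n) :
  M = M *m M *m X -> mxindex M = 1%N.
Proof.
move=> MX; rewrite /mxindex; case: ex_minnP => k /andP[k0 _] kmin.
apply/eqP; rewrite eqn_leq k0 andbT; apply: kmin => /=.
rewrite expr2 expr1 -mulmxE eqn_leq mxrankM_maxl /=.
by rewrite {1}MX mxrankM_maxl.
Qed.

(** If [M = M^2 X] and [M = W M^2], then [W M = M X], and
    [M X X] is the group inverse. *)
Lemma group_inverseP (F : fieldType) (n : nat) (M : 'M[F]_n) :
  mxindex M = 1%N -> is_group_inverse M (group_inverse M).
Proof.
move/mxindex1_rank => rk.
have [X MX] := mxrank_mulr_eq rk; have [W MW] := mxrank_mull_eq rk.
suff /xgetPex h : (exists G, is_group_inverse M G) by apply: (h 0).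
have WX : W *m M = M *m X by rewrite {1}MX !mulmxA -(mulmxA W) -MW.
have MXM : M *m X *m M = M by rewrite -WX -mulmxA -MW.
have GM : M *m X *m X *m M = M *m X.
  by rewrite -WX -(mulmxA W) -WX -mulmxA -(mulmxA W) -MW.
exists (M *m X *m X); split.
- by rewrite mulmxA GM MXM.
- by rewrite GM !mulmxA MXM.
- by rewrite GM !mulmxA -MX.
Qed.

(** Since [M'] is a multiple of its group inverse, on either side, [M''] agrees
    with [M'] when multiplied by [M'] on the left or on the right.  The group
    inverse of [M] is a multiple of [M'], as [G = M G G = M' G G] on one side
    and [G = G G M = G G M'] on the other, so [M''] may replace [M'] in
    products with it. *)
Lemma sharp_le_trans (F : fieldType) (n : nat) (M M' M'' : 'M[F]_n) :
  sharp_le M M' -> sharp_le M' M'' -> sharp_le M M''.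
Proof.
case=> iM iM' L1 L2 [_ iM'' L1' L2'].
case: (group_inverseP iM) (group_inverseP iM'); rewrite /sharp_le.
move: (group_inverse M) (group_inverse M') L1 L2 L1' L2' => G G'.
move=> L1 L2 L1' L2' [_ GMG MG] [GMM' _ MG'].
have MM : M'' *m M' = M' *m M' by rewrite -{1}GMM' mulmxA -L1' -mulmxA GMM'.
have MM' : M' *m M'' = M' *m M'.
  have E : M' *m M' *m G' = M' by rewrite -mulmxA MG' mulmxA MG' -mulmxA GMM'.
  by rewrite -{1}E -mulmxA -L2' mulmxA E.
have Gl : G = M' *m G *m G by rewrite -L1 MG GMG.
have Gr : G = G *m (G *m M') by rewrite -L2 -MG mulmxA GMG.
split=> //.
  by rewrite L1 Gl !mulmxA MM.
by rewrite L2 Gr -!mulmxA MM'.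
Qed.

(** * Orthogonality to a column space *)

Lemma trmxC_mul (C : numClosedFieldType) (m n p : nat)
    (A : 'M[C]_(m, n)) (B : 'M[C]_(n, p)) : (A *m B) ^t* = B ^t* *m A ^t*.
Proof. by rewrite trmx_mul map_mxM. Qed.

(** The diagonal entries of [D^* D] are the squared norms of the columns
    of [D]. *)
Lemma gram_eq0 (C : numClosedFieldType) (m n : nat) (D : 'M[C]_(m, n)) :
  D ^t* *m D = 0 -> D = 0.
Proof.
move=> DD; apply/matrixP => i j; rewrite mxE.
have /eqP := congr1 (fun X : 'M_n => X j j) DD; rewrite !mxE.
have -> : \sum_k D ^t* j k * D k j = \sum_k `|D k j| ^+ 2.
  by apply: eq_bigr => k _; rewrite !mxE normCK mulrC.
rewrite psumr_eq0 => [/allP/(_ i)|k _]; last by rewrite exprn_ge0.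
by rewrite mem_index_enum expf_eq0 normr_eq0 /= => /(_ isT) /eqP.
Qed.

Lemma trmxC_mul_cancel (C : numClosedFieldType) (m n p : nat)
    (M : 'M[C]_(m, n)) (D : 'M[C]_(n, p)) :
  M ^t* *m (M *m D) = 0 -> M *m D = 0.
Proof. by move=> h; apply: gram_eq0; rewrite trmxC_mul -mulmxA h mulmx0. Qed.

(** The normal equations are solvable because [M] and [M^* M] have the same
    null space, hence the same row space. *)
Lemma normal_equations (C : numClosedFieldType) (m n p : nat)
    (M : 'M[C]_(m, n)) (A : 'M[C]_(m, p)) :
  exists Y, M ^t* *m (M *m Y) = M ^t* *m A.
Proof.
have sM : (M <= M ^t* *m M)%MS.
  by rewrite submxE; apply/eqP/trmxC_mul_cancel; rewrite mulmxA mulmx_coker.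
have /submxP [W AW] := submx_trans (submxMl (A ^t*) M) sM.
exists (W ^t*); apply: (can_inj (@trmxCK _ _ _)).
by rewrite !trmxC_mul !trmxCK AW mulmxA.
Qed.

(** * The core-EP decomposition *)

(** As [A2 A1 = 0], every word of length [j] in [A1] and [A2] other than
    [A2 ^+ j] either vanishes or starts with [A1]. *)
Lemma exprD_split (F : fieldType) (n : nat) (A1 A2 : 'M[F]_n) (j : nat) :
  A2 *m A1 = 0 -> exists Z, (A1 + A2) ^+ j = A1 *m Z + A2 ^+ j.
Proof.
move=> A21; elim: j => [|j [Z IH]]; first by exists 0; rewrite mulmx0 add0r.
exists (A1 *m Z + A2 ^+ j).
rewrite exprS IH -mulmxE mulmxDl (mulmxDr A2) mulmxA A21 mul0mx add0r.
by rewrite exprS.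
Qed.

(** By the same vanishing, [A] acts as [A1] on the range of [A1]; as [A1] is a
    multiple of each of its powers, its range lies in that of each power
    of [A]. *)
Lemma core_range_sub (F : fieldType) (n : nat) (A1 A2 : 'M[F]_n) (j : nat) :
  mxindex A1 = 1%N -> A2 *m A1 = 0 -> exists Y, A1 = (A1 + A2) ^+ j *m Y.
Proof.
move=> /mxindex1_rank/mxrank_mulr_eq [X A1X] A21.
elim: j => [|j [Y IH]]; first by exists A1; rewrite expr0 mul1mx.
exists (Y *m X).
by rewrite exprS -mulmxE -mulmxA (mulmxA _ Y) -IH mulmxA mulmxDl A21 addr0.
Qed.

(** Writing [A1 = M Y] gives [M^* A2 = 0].  Then [A2 M = 0], because [A M] has
    range in that of [M], so that [A1 M = A M]; this makes [A1] of index one.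
    The last term of [M = A1 Z + A2 ^+ k] has range in that of [M] and is
    orthogonal to it. *)
Lemma core_EP_exists (R : realType) (n : nat) (A : 'M[R[i]]_n) :
  exists A1 A2, core_EP A A1 A2.
Proof.
have [] := mxindexP A; set k := mxindex A => k0 rk.
set M := A ^+ k.
have AM : A *m M = M *m A by rewrite mulmxE -exprS -exprSr.
have [T MT] : exists T, M = M *m A *m T.
  by apply: mxrank_mulr_eq; rewrite mulmxE -exprSr.
have [Y MY] := normal_equations M A.
pose A1 := M *m Y; pose A2 := A - A1.
have AE : A = A1 + A2 by rewrite addrC subrK.
have MA2 : M ^t* *m A2 = 0 by rewrite mulmxBr MY subrr.
have A2M : A2 *m M = 0.
  have A2E : A2 *m M = M *m (A - Y *m M) by rewrite mulmxBl AM mulmxBr mulmxA.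
  by rewrite A2E; apply: trmxC_mul_cancel; rewrite -A2E mulmxA MA2 mul0mx.
have A1M : A1 *m M = M *m A by rewrite -AM {1}AE mulmxDl A2M addr0.
have A21 : A2 *m A1 = 0 by rewrite mulmxA A2M mul0mx.
exists A1, A2; split=> //.
- have A1MT : A1 *m (M *m T) = M by rewrite mulmxA A1M -MT.
  apply: (@mxindex1_intro _ _ _ (M *m T *m (T *m Y))).
  rewrite -(mulmxA A1 A1) (mulmxA A1 (M *m T)) A1MT.
  by rewrite (mulmxA M T) (mulmxA A1 (M *m T)) A1MT.
- have [Z MZ] := exprD_split k A21.
  rewrite -AE -/M -/k in MZ.
  have A2k : A2 ^+ k = M *m (1%:M - Y *m Z).
    by rewrite mulmxBr mulmx1 mulmxA -/A1 {1}MZ addrC addKr.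
  rewrite -/k A2k; apply: trmxC_mul_cancel; rewrite -A2k.
  by rewrite -(prednK k0) exprS -mulmxE mulmxA MA2 mul0mx.
- by rewrite trmxC_mul -mulmxA MA2 mulmx0.
Qed.

(** The range of [A1] is that of [M := A ^+ k] for any decomposition, so
    [A1^* A2 = 0] gives [M^* A2 = 0], that is [M^* A1 = M^* A].  The difference
    of two candidates for [A1] thus has its range in that of [M] and is killed
    by [M^*]. *)
Lemma core_EP_unique (R : realType) (n : nat) (A A1 A2 B1 B2 : 'M[R[i]]_n) :
  core_EP A A1 A2 -> core_EP A B1 B2 -> A1 = B1.
Proof.
set M := A ^+ mxindex A.
have key C1 C2 : core_EP A C1 C2 ->
    M ^t* *m C1 = M ^t* *m A /\ exists Y, C1 = M *m Y.
  case=> AE i1 C2k C12 C21.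
  have [Y C1Y] := core_range_sub (mxindex A) i1 C21.
  have [Z MZ] := exprD_split (mxindex A) C21.
  rewrite -AE C2k addr0 -/M in MZ; rewrite -AE -/M in C1Y.
  split; last by exists Y.
  have MC2 : M ^t* *m C2 = 0 by rewrite MZ trmxC_mul -mulmxA C12 mulmx0.
  by rewrite AE mulmxDr MC2 addr0.
move=> /key [MA [Y A1Y]] /key [MB [Y' B1Y]]; apply/subr0_eq.
rewrite A1Y B1Y -mulmxBr; apply: trmxC_mul_cancel.
by rewrite mulmxBr -A1Y -B1Y mulmxBr MA MB subrr.
Qed.

Theorem theorem4p1 (R : realType) (n : nat) :
  (forall A : 'M[R[i]]_n, WG_le A A) /\
  (forall A B D : 'M[R[i]]_n, WG_le A B -> WG_le B D -> WG_le A D).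
Proof.
split=> [A | A B D [A1 [A2 [B1 [B2 [cA cB AB]]]]]].
  have [A1 [A2 cA]] := core_EP_exists A; have [_ iA1 _ _ _] := cA.
  by exists A1, A2, A1, A2; split.
case=> [B1' [B2' [D1 [D2 [cB' cD BD]]]]].
exists A1, A2, D1, D2; split=> //; apply: sharp_le_trans AB _.
by rewrite (core_EP_unique cB cB').
Qed.
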